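(* Let $S,T\in B(\mathcal H)$ be such that $S,T\in[DN]$ and both $S$ and $T$ have Drazin index $1$. Let $C\in B(\mathcal H)$, regarded as an operator $C:S(\mathcal H)\oplus S^{-1}(0)\to T(\mathcal H)\oplus T^{-1}(0)$, have the matrix representation $C=[C_{ij}]_{i,j=1}^2$, and let $$A=\begin{pmatrix}T&C\\0&S\end{pmatrix}\in B(\mathcal H\oplus\mathcal H).$$ Then $A\in[DN]$ if and only if $C=0\oplus C_{22}$ (i.e. $C_{11}=0$, $C_{12}=0$ and $C_{21}=0$).
   Context: $\mathcal H$ is a complex infinite dimensional Hilbert space and $B(\mathcal H)$ is the algebra of bounded linear operators on $\mathcal H$; $[X,Y]=XY-YX$. An operator $T$ on a Hilbert space is Drazin invertible if there is a bounded operator $T_d$ (the Drazin inverse) with $[T_d,T]=0$, $T_d^2T=T_d$ and $T^{p+1}T_d=T^p$ for some integer $p\ge1$; the (least such) $p$ is the Drazin index of $T$ (if $T$ is invertible, $T_d=T^{-1}$). $T\in[DN]$ (equivalently $T\in[(1,1)DN]$) means that $T$ is Drazin invertible and $[T_d,T^*]=0$. $T^{-1}(0)$ denotes the kernel of $T$ and $T(\mathcal H)$ its range; for $T$ of Drazin index $1$, $\mathcal H=T(\mathcal H)\oplus T^{-1}(0)$. In the matrix $[C_{ij}]$, the first index refers to the summands $T(\mathcal H),T^{-1}(0)$ and the second to $S(\mathcal H),S^{-1}(0)$, so that e.g. $C_{22}:S^{-1}(0)\to T^{-1}(0)$. *)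

(* Defs.v *)
From HB Require Import structures.
From mathcomp Require Import all_boot all_order all_algebra sesquilinear.
From mathcomp Require Import complex ring lra.
From mathcomp Require Import all_classical all_reals all_analysis.

Set Implicit Arguments.
Unset Strict Implicit.
Unset Printing Implicit Defensive.

Import Order.TTheory GRing.Theory Num.Theory Num.Def.
Import numFieldNormedType.Exports.

Local Open Scope classical_set_scope.
Local Open Scope complex_scope.
Local Open Scope ring_scope.

Reserved Notation "{ 'bounded' H -> K }"
  (at level 0, H at level 98, K at level 99, format "{ 'bounded'  H  ->  K }").
Reserved Notation "H \oplus K" (at level 50, left associativity).
Reserved Notation "T ^\dagger" (at level 2, format "T ^\dagger").

(* CauchySchwarz and triangle_lerif of sesquilinear are restricted to vectType,
   that is, to finite dimension *)
Section dot_lmodType.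
Variables (C : numClosedFieldType) (U : lmodType C) (form : {dot U for conjC}).
Local Notation "''[' u , v ]" := (form u v) : ring_scope.
Local Notation "''[' u ]" := (form u u) : ring_scope.

Lemma dot_CauchySchwarz u v : `|'[u, v]| ^+ 2 <= '[u] * '[v].
Proof.
have [->|nz_v] := eqVneq v 0; first by rewrite !linear0r normr0 expr0n.
wlog ou : u / '[u, v] = 0.
  move=> IHo; pose a := '[u, v] / '[v]; pose u1 := u - a *: v.
  have ou : '[u1, v] = 0.
    rewrite linearBl/= linearZl_LR.
    by rewrite divfK ?dnorm_eq0 ?subrr.
  rewrite (canRL (subrK _) (erefl u1)) linearDl /= ou add0r.
  rewrite linearZl_LR/= normrM (ger0_norm (dnorm_ge0 _ _)).
  rewrite exprMn hnormDd/=; last by rewrite linearZr_LR/= ou mulr0.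
  by rewrite mulrDl dnormZ expr2 mulrA lerDr mulr_ge0 ?dnorm_ge0.
by rewrite ou normr0 expr0n mulr_ge0 ?dnorm_ge0.
Qed.

Lemma dot_norm_ge u v : `|'[u, v]| <= sqrtC '[u] * sqrtC '[v].
Proof.
rewrite -(sqrCK (normr_ge0 _)) -sqrtCM ?nnegrE ?dnorm_ge0//.
by rewrite ler_sqrtC ?dot_CauchySchwarz// ?nnegrE ?mulr_ge0 ?dnorm_ge0// exprn_ge0.
Qed.

Lemma dot_triangle u v : sqrtC '[u + v] <= sqrtC '[u] + sqrtC '[v].
Proof.
rewrite -ler_sqr ?nnegrE ?addr_ge0 ?sqrtC_ge0 ?dnorm_ge0//.
rewrite sqrrD !sqrtCK dnormD/= addrAC lerD2r lerD2l.
have two0 : (2 : C) != 0 by rewrite pnatr_eq0.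
rewrite -[leLHS](divfK two0) -ReE mulr_natr lerMn2r/=.
by rewrite (le_trans (leif_Re_Creal _).1)// dot_norm_ge.
Qed.

End dot_lmodType.

HB.mixin Record NormedModule_isHilbert (R : realType) H
    & NormedModule R[i] H := {
  dotp : {dot H for @conjC R[i]};
  dotpE : forall x : H, dotp x x = `|x| ^+ 2
}.

#[short(type="hilbertType")]
HB.structure Definition Hilbert (R : realType) :=
  {H of CompleteNormedModule R[i] H & NormedModule_isHilbert R H}.

Definition hsum (H K : Type) : Type := (H * K)%type.
Notation "H \oplus K" := (hsum H K) : type_scope.

Section hilbert_sum.
Variables (R : realType) (H K : hilbertType R).
Local Notation C := R[i].

HB.instance Definition _ := GRing.Lmodule.copy (H \oplus K) (H * K)%type.

Definition hsum_dot (x y : H \oplus K) : C := dotp x.1 y.1 + dotp x.2 y.2.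

Let hsum_dot_bilinear : bilinear_for *%R (@conjC C \; *%R) hsum_dot.
Proof.
split=> [u|u] a v w; rewrite /hsum_dot/=.
  by rewrite !linearPl/= mulrDr addrACA.
by rewrite !linearP/= mulrDr addrACA.
Qed.

HB.instance Definition _ :=
  bilinear_isBilinear.Build C _ _ C _ _ hsum_dot hsum_dot_bilinear.

Let hsum_dotC x y : hsum_dot x y = (-1) ^+ false * conjC (hsum_dot y x).
Proof.
by rewrite /hsum_dot rmorphD/= mulrDr; congr +%R; apply: hermC.
Qed.

HB.instance Definition _ :=
  isHermitianSesquilinear.Build C _ false (@conjC C) hsum_dot hsum_dotC.

Let hsum_dot_gt0 x : x != 0 -> 0 < hsum_dot x x.
Proof.
move=> x0; rewrite lt_def /hsum_dot !dotpE addr_ge0 ?exprn_ge0// andbT.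
apply: contra x0; rewrite paddr_eq0 ?exprn_ge0// !sqrf_eq0 !normr_eq0.
by case: x => a b /= /andP[/eqP-> /eqP->].
Qed.

HB.instance Definition _ := isDotProduct.Build C _ hsum_dot hsum_dot_gt0.

Definition hsum_norm (x : H \oplus K) : C := sqrtC (hsum_dot x x).

Let hsum_normD x y : hsum_norm (x + y) <= hsum_norm x + hsum_norm y.
Proof. exact: dot_triangle. Qed.

Let hsum_normZ (a : C) x : hsum_norm (a *: x) = `|a| * hsum_norm x.
Proof.
rewrite /hsum_norm dnormZ sqrtCM ?nnegrE ?exprn_ge0 ?dnorm_ge0//.
by rewrite sqrCK.
Qed.

Let hsum_norm0_eq0 x : hsum_norm x = 0 -> x = 0.
Proof. by move/eqP; rewrite sqrt_dnorm_eq0 => /eqP. Qed.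

HB.instance Definition _ := @Lmodule_isNormed.Build C (H \oplus K)
  hsum_norm hsum_normD hsum_normZ hsum_norm0_eq0.

Lemma hsum_normE (x : H \oplus K) : `|x| = sqrtC (`|x.1| ^+ 2 + `|x.2| ^+ 2).
Proof. by rewrite [LHS]/(hsum_norm _) /hsum_norm /hsum_dot !dotpE. Qed.

Lemma hsum_norm_fst (x : H \oplus K) : `|x.1| <= `|x|.
Proof.
by rewrite hsum_normE -[leLHS]sqrCK// ler_sqrtC ?nnegrE ?addr_ge0 ?exprn_ge0//
  lerDl exprn_ge0.
Qed.

Lemma hsum_norm_snd (x : H \oplus K) : `|x.2| <= `|x|.
Proof.
by rewrite hsum_normE -[leLHS]sqrCK// ler_sqrtC ?nnegrE ?addr_ge0 ?exprn_ge0//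
  lerDr exprn_ge0.
Qed.

Lemma hsum_norm_le (x : H \oplus K) : `|x| <= `|x.1| + `|x.2|.
Proof.
rewrite hsum_normE -[leRHS]sqrCK ?addr_ge0//.
rewrite ler_sqrtC ?nnegrE ?addr_ge0 ?exprn_ge0 ?addr_ge0//.
by rewrite sqrrD lerD2r lerDl mulrn_wge0 ?mulr_ge0.
Qed.

Let hsum_complete (F : set_system (H \oplus K)) :
  ProperFilter F -> cauchy F -> cvg F.
Proof.
move=> FF /cauchy_ballP Fc.
have c1 : cvg (fst @ F).
  apply: cauchy_cvg; apply/cauchy_ballP => e e0.
  have [[A B] /= [FA FB] AB] := Fc e e0.
  exists (fst @` A, fst @` B) => /=.
    by split; [apply: filterS FA => x|apply: filterS FB => x]; exists x.
  move=> [_ _] /= [[x Ax <-] [y By <-]].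
  have := AB (x, y) (conj Ax By).
  rewrite -!ball_normE /=; apply: le_lt_trans.
  exact: (hsum_norm_fst (x - y)).
have c2 : cvg (snd @ F).
  apply: cauchy_cvg; apply/cauchy_ballP => e e0.
  have [[A B] /= [FA FB] AB] := Fc e e0.
  exists (snd @` A, snd @` B) => /=.
    by split; [apply: filterS FA => x|apply: filterS FB => x]; exists x.
  move=> [_ _] /= [[x Ax <-] [y By <-]].
  have := AB (x, y) (conj Ax By).
  rewrite -!ball_normE /=; apply: le_lt_trans.
  exact: (hsum_norm_snd (x - y)).
pose l : H \oplus K := (lim (fst @ F), lim (snd @ F)).
apply/cvg_ex; exists l; apply/cvgrPdist_lt => e e0.
have e20 : 0 < e / 2 by rewrite divr_gt0.
have /cvgrPdist_lt/(_ _ e20) n1 := c1.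
have /cvgrPdist_lt/(_ _ e20) n2 := c2.
near=> x.
rewrite (le_lt_trans (hsum_norm_le _))// (splitr e) ltrD//=.
  by near: x.
by near: x.
Unshelve. all: by end_near. Qed.

HB.instance Definition _ :=
  Uniform_isComplete.Build (H \oplus K) hsum_complete.

Let hsum_dotE (x : H \oplus K) : hsum_dot x x = `|x| ^+ 2.
Proof. by rewrite hsum_normE sqrtCK /hsum_dot !dotpE. Qed.

HB.instance Definition _ :=
  NormedModule_isHilbert.Build R (H \oplus K) hsum_dotE.

End hilbert_sum.

HB.mixin Record isBoundedFun (R : realType) (H K : hilbertType R)
    (f : H -> K) := {
  bounded_fun_ex : exists M : R[i], forall x, `|f x| <= M * `|x|
}.

(* the bounded linear operators from H to K; B(H) is {bounded H -> H} *)
#[short(type="boundedOp")]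
HB.structure Definition BoundedOp (R : realType) (H K : hilbertType R) :=
  {f of @GRing.Linear R[i] H K *:%R f & isBoundedFun R H K f}.

Notation "{ 'bounded' H -> K }" := (boundedOp H%type K%type) : type_scope.

Section bounded_operators.
Variables (R : realType) (H K : hilbertType R).

Let null_fun_bounded :
  exists M : R[i], forall x : H, `|(\0 : H -> K) x| <= M * `|x|.
Proof. by exists 0 => x; rewrite normr0 mul0r. Qed.

HB.instance Definition _ :=
  isBoundedFun.Build R H K (\0 : H -> K) null_fun_bounded.

Lemma bounded_fun_ge0 (f : {bounded H -> K}) :
  exists2 M : R[i], 0 <= M & forall x, `|f x| <= M * `|x|.
Proof.
have [M fM] := @bounded_fun_ex _ _ _ f.
exists `|M| => // x; have := fM x.
have [->|x0] := eqVneq x 0; first by rewrite !linear0 !normr0 !mulr0.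
move=> /[dup] /(le_trans (normr_ge0 _)).
by rewrite pmulr_lge0 ?normr_gt0// => /ger0_norm ->.
Qed.

End bounded_operators.

Section block_operator.
Variables (R : realType) (H1 H2 K1 K2 : hilbertType R).
Variables (A11 : {bounded H1 -> K1}) (A12 : {bounded H2 -> K1}).
Variables (A21 : {bounded H1 -> K2}) (A22 : {bounded H2 -> K2}).

Definition block_op (x : H1 \oplus H2) : K1 \oplus K2 :=
  (A11 x.1 + A12 x.2, A21 x.1 + A22 x.2).

Let block_op_linear : linear block_op.
Proof.
move=> a x y; rewrite /block_op/= !linearP/=.
by congr pair => /=; rewrite scalerDr addrACA.
Qed.

HB.instance Definition _ :=
  @GRing.isLinear.Build R[i] _ _ _ block_op block_op_linear.

Let block_op_bounded : exists M, forall x, `|block_op x| <= M * `|x|.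
Proof.
have [M11 p11 b11] := bounded_fun_ge0 A11.
have [M12 p12 b12] := bounded_fun_ge0 A12.
have [M21 p21 b21] := bounded_fun_ge0 A21.
have [M22 p22 b22] := bounded_fun_ge0 A22.
exists (M11 + M12 + (M21 + M22)) => x.
rewrite (le_trans (hsum_norm_le _))// mulrDl !mulrDl.
have H1le := hsum_norm_fst x; have H2le := hsum_norm_snd x.
rewrite lerD// (le_trans (ler_normD _ _))// lerD//.
- by rewrite (le_trans (b11 _))// ler_wpM2l.
- by rewrite (le_trans (b12 _))// ler_wpM2l.
- by rewrite (le_trans (b21 _))// ler_wpM2l.
- by rewrite (le_trans (b22 _))// ler_wpM2l.
Qed.

HB.instance Definition _ := isBoundedFun.Build R _ _ block_op block_op_bounded.

End block_operator.

Section riesz.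
Variables (R : realType) (H : hilbertType R).
Local Notation C := R[i].
Implicit Types x y u v : H.

Local Notation Re := complex.Re.

Let b x y : R := Re (dotp x y).
Let q x := b x x.

Let qE x : q x = Re `|x| ^+ 2.
Proof. by rewrite /q /b dotpE -{1}(RRe_real (normr_real x)) -rmorphXn. Qed.

Let bC x y : b x y = b y x.
Proof.
by rewrite /b hermC/= mul1r; case: (dotp y x).
Qed.

Let bDl x y z : b (x + y) z = b x z + b y z.
Proof. by rewrite /b linearDl/= raddfD. Qed.

Let bZl (a : R) x y : b (a%:C *: x) y = a * b x y.
Proof. by rewrite /b linearZl_LR/=; case: (dotp x y) => c d; simpc. Qed.

Let qD x y : q (x + y) = q x + q y + 2 * b x y.
Proof. rewrite /q !bDl ![b _ (x + y)]bC !bDl (bC y x); lra. Qed.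

Let qZ (a : R) x : q (a%:C *: x) = a ^+ 2 * q x.
Proof. by rewrite /q bZl bC bZl mulrA expr2. Qed.

Let q_ge0 x : 0 <= q x. Proof. by rewrite qE sqr_ge0. Qed.

Let b_le x y : `|b x y| <= Re `|x| * Re `|y|.
Proof.
have := dot_norm_ge (@dotp R H) x y.
rewrite !dotpE !sqrCK// -{1}(RRe_real (normr_real x)).
rewrite -{1}(RRe_real (normr_real y)).
move=> /(le_trans (normc_ge_Re _)).
by rewrite -rmorphM/= lecR.
Qed.

Lemma riesz (f : H -> C) : linear_for *%R f ->
  (exists M : C, forall x, `|f x| <= M * `|x|) ->
  exists u, forall x, f x = dotp x u.
Proof.
move=> lf [M fM].
pose g x := Re (f x).
have gD x y : g (x + y) = g x + g y.
  by have := lf 1 x y; rewrite scale1r mul1r /g => ->; rewrite raddfD.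
have gZ (a : R) x : g (a%:C *: x) = a * g x.
  have f0 : f 0 = 0.
    by have := lf (-1) 0 0; rewrite scaler0 addr0 mulN1r addNr.
  have := lf a%:C x 0; rewrite !addr0 f0 addr0 /g => ->.
  by case: (f x) => c d; simpc.
pose J x := q x - 2 * g x.
have J_lb x : - (Re M) ^+ 2 <= J x.
  have gM : g x <= Re M * Re `|x|.
    have gf : g x <= Re `|f x|.
      have := normc_ge_Re (f x).
      rewrite -{1}(RRe_real (normr_real (f x))) lecR.
      exact/le_trans/ler_norm.
    apply: (le_trans gf); have := fM x.
    rewrite lecE => /andP[_]; rewrite -(RRe_real (normr_real x)).
    by case: M {fM} => c d; simpc.
  rewrite /J qE; have := sqr_ge0 (Re `|x| - Re M); nra.
pose m := inf (range J).
have Jinf : has_inf (range J).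
  split; first by exists (J 0), 0.
  by exists (- (Re M) ^+ 2) => _ [x _ <-].
have mJ x : m <= J x by apply: ge_inf; [case: Jinf|exists x].
pose F : set_system H :=
  filter_from [set e : R | 0 < e] (fun e => [set x | J x < m + e]).
have FF : ProperFilter F.
  apply: filter_from_proper; last first.
    move=> e /= e0; have [_ [x _ <-] xe] := inf_adherent e0 Jinf.
    by exists x.
  apply: filter_from_filter; first by exists 1 => /=.
  move=> e d /= e0 d0; exists (Num.min e d) => /=; first by rewrite lt_min e0.
  by move=> x /=; rewrite -!ltrBlDl lt_min => /andP[].
have Jpar x y : q (x - y) = 2 * J x + 2 * J y - 4 * J (2^-1%:C *: (x + y)).
  have -> : x - y = x + (-1)%:C *: y by rewrite rmorphN/= scaleN1r.
  rewrite /J qZ gZ gD !qD qZ (bC x) bZl (bC y); by field.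
have Fc : cauchy F.
  apply: cauchy_exP => e e0.
  have Re0 : 0 < Re e by move: e0; rewrite ltcE => /andP[].
  have eE : e = (Re e)%:C by rewrite RRe_real// gtr0_real.
  pose d : R := Re e ^+ 2 / 4.
  have d0 : 0 < d by rewrite divr_gt0// exprn_gt0.
  have [_ [x _ <-] xe] := inf_adherent d0 Jinf.
  exists x; exists d => //= y /= yd.
  rewrite -ball_normE/= -(RRe_real (normr_real (x - y))) eE ltcR.
  rewrite -ltr_sqr ?nnegrE ?(ltW Re0)//; last first.
    by have := normr_ge0 (x - y); rewrite lecE => /andP[].
  rewrite -qE Jpar.
  have := mJ (2^-1%:C *: (x + y)).
  rewrite -/m in xe.
  have : 4 * d = Re e ^+ 2 by rewrite /d mulrC divfK.
  lra.
have /cvg_ex[u Fu] : cvg F by exact: cauchy_cvg.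
have var x : 0 <= q x + 2 * (b u x - g x).
  apply/ler_addgt0Pr => e e0.
  pose n := Re `|x|.
  have n0 : 0 <= n by have := normr_ge0 x; rewrite lecE => /andP[].
  have d0 : 0 < e / (4 * (n + 1)) by rewrite divr_gt0// mulr_gt0// ltr_wpDl.
  have d0C : 0 < (e / (4 * (n + 1)))%:C by rewrite ltcR.
  have near_u := Fu _ (nbhsx_ballx u _ d0C).
  have near_m : F [set v | J v < m + e / 2].
    by exists (e / 2) => //=; rewrite divr_gt0.
  have [v [/= uv vm]] := filter_ex (filterI near_u near_m).
  have := mJ (v + x); rewrite /J qD gD -/(J v).
  have -> : b u x = b (u - v) x + b v x by rewrite -bDl subrK.
  have : `|b (u - v) x| <= e / 4.
    rewrite (le_trans (b_le _ _))//.
    move: uv; rewrite -ball_normE/= -(RRe_real (normr_real (u - v))) ltcR -/n => uv.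
    rewrite (@le_trans _ _ (e / (4 * (n + 1)) * n)) ?ler_wpM2r ?(ltW uv)//.
    rewrite invfM mulrA -mulrA ler_piMr ?divr_ge0 ?(ltW e0)//.
    by rewrite mulrC ler_pdivrMr ?ltr_wpDl// mul1r lerDl.
  rewrite ler_norml => /andP[? ?]; move: vm; rewrite /J; lra.
have bg x : g x = b u x.
  apply/eqP; rewrite eq_sym -subr_eq0; set d := b u x - g x; apply/eqP.
  have s0 : 0 < q x + 1 by rewrite ltr_wpDl.
  have := var ((- d / (q x + 1))%:C *: x).
  rewrite qZ gZ (bC u) bZl (bC x) -mulrBr -/d.
  have -> : (- d / (q x + 1)) ^+ 2 * q x + 2 * (- d / (q x + 1) * d) =
      - (d ^+ 2 * ((q x + 2) / (q x + 1) ^+ 2)) by field; rewrite gt_eqF.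
  rewrite oppr_ge0 pmulr_lle0; last by rewrite divr_gt0 ?exprn_gt0// ltr_wpDl.
  by move=> d2; apply/eqP; rewrite -sqrf_eq0 eq_le d2 sqr_ge0.
exists u => x.
have fi : f ('i%C *: x) = 'i%C * f x.
  have f0 : f 0 = 0.
    by have := lf (-1) 0 0; rewrite scaler0 addr0 mulN1r addNr.
  by have := lf 'i%C x 0; rewrite !addr0 f0 addr0.
have := bg x; have := bg ('i%C *: x).
rewrite !(bC u) /g /b fi linearZl_LR/= !(mulrC 'i%C) !ReiNIm.
by case: (f x) (dotp x u) => c d [c' d'] /= /oppr_inj -> ->.
Qed.

End riesz.

Section adjoint.
Variables (R : realType) (H K : hilbertType R) (T : {bounded H -> K}).

Lemma adjoint_ex :
  exists T' : {bounded K -> H}, forall x y, dotp (T x) y = dotp x (T' y).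
Proof.
have [M M0 TM] := bounded_fun_ge0 T.
have Ty y : exists u, forall x, dotp (T x) y = dotp x u.
  apply: riesz; first by move=> a x x'; rewrite linearP linearPl.
  exists (M * `|y|) => x; rewrite (le_trans (dot_norm_ge _ _ _))//.
  by rewrite !dotpE !sqrCK// mulrAC ler_wpM2r.
pose T' y := xget 0 [set u | forall x, dotp (T x) y = dotp x u].
have T'E x y : dotp (T x) y = dotp x (T' y).
  by rewrite /T'; case: xgetP => [u _ ->//|/= nu]; have [u /nu] := Ty y.
have inj (u v : H) : (forall x, dotp x u = dotp x v) -> u = v.
  move=> uv; apply/eqP; rewrite -subr_eq0 -(dnorm_eq0 (@dotp R H)).
  by rewrite linearB/= uv subrr.
have T'lin : linear T'.
  move=> a y z; apply: inj => x.
  by rewrite linearPr/= -!T'E linearPr.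
have T'bd : exists M : R[i], forall y, `|T' y| <= M * `|y|.
  exists M => y; have [->|y0] := eqVneq (T' y) 0.
    by rewrite normr0 mulr_ge0.
  rewrite -(@ler_pM2r _ `|T' y|) ?normr_gt0//.
  rewrite -expr2 -dotpE -T'E.
  rewrite -[leLHS]ger0_norm; last by rewrite T'E dotpE exprn_ge0.
  rewrite (le_trans (dot_norm_ge _ _ _))// !dotpE !sqrCK//.
  by rewrite mulrAC ler_wpM2r.
pose T1 : {linear K -> H} := HB.pack T' (GRing.isLinear.Build _ _ _ _ _ T'lin).
pose T2 : {bounded K -> H} := HB.pack T' (isBoundedFun.Build R K H T' T'bd) T1.
by exists T2.
Qed.

Definition adjoint : {bounded K -> H} := projT1 (cid adjoint_ex).

Lemma adjointE x y : dotp (T x) y = dotp x (adjoint y).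
Proof. by rewrite /adjoint; case: cid. Qed.

End adjoint.

Notation "T ^\dagger" := (adjoint T) : ring_scope.

(* Powers of T are iterates: iter p T is T ^ p. *)
Section drazin.
Variables (R : realType) (H : hilbertType R) (T : {bounded H -> H}).

Definition is_drazin (p : nat) (Td : {bounded H -> H}) : Prop :=
  [/\ (0 < p)%N, Td \o T =1 T \o Td, Td \o Td \o T =1 Td &
      iter p.+1 T \o Td =1 iter p T].

Definition drazin_inverse (Td : {bounded H -> H}) : Prop :=
  exists p, is_drazin p Td.

Definition drazin_index (p : nat) : Prop :=
  (exists Td, is_drazin p Td) /\
  forall q, (exists Td, is_drazin q Td) -> (p <= q)%N.

(* The Drazin inverse is unique, so exists and forall agree here. *)
Definition DN : Prop :=
  exists2 Td, drazin_inverse Td & Td \o T^\dagger =1 T^\dagger \o Td.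

End drazin.

Definition infinite_dimensional (K : nzRingType) (V : lmodType K) : Prop :=
  forall (n : nat) (e : 'I_n -> V),
    exists v : V, forall c : 'I_n -> K, v <> \sum_(i < n) c i *: e i.

Section matrix_entries.
Variables (R : realType) (H : hilbertType R).

(* the projection onto U along V, meaningful when H is the direct sum of U
   and V *)
Definition proj (U V : set H) (x : H) : H :=
  xget 0 [set u | U u /\ V (x - u)].

(* Indices are 0 and 1 where the customary block indices are 1 and 2. *)
Definition summand (T : H -> H) (i : 'I_2) : set H :=
  if i == 0 then range T else T @^-1` [set 0].

(* the (i, j) entry of C with respect to the decompositions
   H = range S (+) ker S of the domain and H = range T (+) ker T of the
   codomain; its values lie in summand T i *)
Definition entry (T S C : H -> H) (i j : 'I_2) : summand S j -> H :=
  fun x => proj (summand T i) (summand T (rev_ord i)) (C (\val x)).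

End matrix_entries.

Arguments entry {R H} T S C i j _.

(* Main.v *)
(** The Drazin inverse of an operator in [DN] commutes with [T] and its
    adjoint, and since [T] restricted to the range of [T Td] is the group
    inverse of [Td], this forces [T] to be normal on the range of [T ^ p]; for
    index 1 it also gives [ker T = ker T^*].  Let [A] be the block operator.
    If [A] is in [DN], then |A u| = |A^* u| on the ranges of high powers of [A]
    and of [A^*].  Taking u = (v, 0) with v in the range of [T] leaves
    |T v|^2 = |T^* v|^2 + |C^* v|^2, hence [C^* v = 0]; taking u = (0, v) with v
    in the range of [S^*] leaves [C v = 0].  So [T C = 0] and [C S = 0], which
    says that only [C22] survives.  Conversely these two equations make the
    direct sum of [Td] and [Sd] a Drazin inverse of [A] commuting with [A^*]. *)
Require Import Defs.
From HB Require Import structures.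
From mathcomp Require Import all_boot all_order all_algebra.
From mathcomp Require Import complex.
From mathcomp Require Import all_classical all_reals all_analysis.
From mathcomp Require Import sesquilinear.

Set Implicit Arguments.
Unset Strict Implicit.

Import GRing.Theory Num.Theory.

Local Open Scope classical_set_scope.
Local Open Scope ring_scope.

(** * Commutation with a group inverse *)

Section composition_identities.
Context {X : Type} {A B D : X -> X}.
Hypothesis AB : forall x, B (A x) = A (B x).
Hypothesis BBA : forall x, B (B (A x)) = B x.
Hypothesis BD : forall x, B (D x) = D (B x).

Let ABB x : A (B (B x)) = B x.
Proof. by rewrite -AB -AB BBA. Qed.

Let BAB x : B (A (B x)) = B x.
Proof. by rewrite AB ABB. Qed.

Let BAAB x : B (A (A (B x))) = A (B x).
Proof. by rewrite AB BAB. Qed.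

(* With [E = A B] and the group inverse [G = A A B] of [B], both [E D] and
   [D E] equal [E D E]: write [E = G B] on the left, or [E = B G] on the right,
   and move [B] through [D]. *)
Lemma comm_core_proj x : D (A (B x)) = A (B (D x)).
Proof.
transitivity (A (B (D (A (B x))))).
  by rewrite -{1 2}BAAB -!BD ABB.
by rewrite -[B (D (A _))]ABB (BD (A _)) BAB -BD ABB.
Qed.

(** [D] commutes with [B] and [A B], hence with [A A B], the inverse of [B] on the range of [A B].
    For [A = T], [B = Td], [D = T^\dagger] this is normality of [T] on that range. *)
Lemma comm_core x : A (D (A (B x))) = D (A (A (B x))).
Proof.
rewrite comm_core_proj -[B (D x)]BAB -comm_core_proj -[A (B x)]BAAB -BD ABB.
by rewrite -comm_core_proj BAAB.
Qed.

End composition_identities.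

(** * Inner product and adjoint *)

Section dot_product.
Context {R : realType} {H : hilbertType R}.
Implicit Types u v : H.

Lemma dotp_inj u v : (forall x, dotp x u = dotp x v) -> u = v.
Proof.
move=> uv; apply/eqP; rewrite -subr_eq0 -(dnorm_eq0 (@dotp R H)).
by rewrite linearB/= uv subrr.
Qed.

Lemma dotp_conj u v : dotp u v = Num.conj (dotp v u).
Proof. by rewrite hermC/= mul1r. Qed.

Lemma dotp_eq0 u : dotp u u = 0 -> u = 0.
Proof. by move/eqP; rewrite dnorm_eq0 => /eqP. Qed.

Lemma dotp0 u : dotp u 0 = 0.
Proof. by rewrite linear0r. Qed.

Lemma dot0p u : dotp 0 u = 0.
Proof. by rewrite linear0l. Qed.

End dot_product.

Section adjoint_involution.
Context {R : realType} {H K : hilbertType R}.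
Implicit Type T : {bounded H -> K}.

Lemma adjointEr T x y : dotp x (T y) = dotp (T^\dagger x) y.
Proof. by rewrite dotp_conj adjointE -dotp_conj. Qed.

Lemma adjointK T : T^\dagger^\dagger =1 T.
Proof. by move=> y; apply: dotp_inj => x; rewrite -adjointE -adjointEr. Qed.

End adjoint_involution.

(** * Drazin inverses, adjoints and normality on the core *)

Section drazin_normal.
Context {R : realType} {H : hilbertType R}.
Implicit Types T Td : {bounded H -> H}.

Lemma adjoint_iter T p x y :
  dotp (iter p T x) y = dotp x (iter p T^\dagger y).
Proof.
by elim: p x y => [//|p IH] x y; rewrite iterS iterSr adjointE IH.
Qed.

Lemma iter_commute (X : Type) (f g : X -> X) p :
  f \o g =1 g \o f -> f \o iter p g =1 iter p g \o f.
Proof. by move=> fg x; elim: p => //= p <-; exact: fg. Qed.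

Lemma drazin_comm T p Td x : is_drazin T p Td -> Td (T x) = T (Td x).
Proof. by case=> _ c1 _ _; exact: c1. Qed.

Lemma drazin_adjoint T p Td :
  is_drazin T p Td -> is_drazin T^\dagger p Td^\dagger.
Proof.
case=> p0 c1 c2 c3; split=> // x; apply: dotp_inj => y.
- by rewrite /= -!adjointE; have /= -> := c1 y.
- by rewrite /= -!adjointE; have /= := c1 (Td y); have /= := c1 y;
    move=> <- <-; have /= -> := c2 y.
- rewrite [comp _ _ x]/comp -!adjoint_iter -adjointE.
  by rewrite [Td _](iter_commute p.+1) ?c3.
Qed.

Lemma adjoint_comm T Td : Td \o T^\dagger =1 T^\dagger \o Td ->
  Td^\dagger \o T^\dagger^\dagger =1 T^\dagger^\dagger \o Td^\dagger.
Proof.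
move=> cT x; apply: dotp_inj => y /=.
by rewrite -!adjointE; have /= -> := cT y.
Qed.

Lemma DN_adjoint T : DN T -> DN T^\dagger.
Proof.
move=> [Td [p dT] cT]; exists Td^\dagger; last exact: adjoint_comm.
by exists p; exact: drazin_adjoint.
Qed.

Lemma drazin_core T p Td x :
  is_drazin T p Td -> T (Td (iter p T x)) = iter p T x.
Proof.
move=> [_ c1 _ c3]; rewrite -[RHS]c3 [comp _ _ x]/comp [iter p.+1 _ _]iterS.
by congr (T _); exact: iter_commute.
Qed.

Lemma core_norm_eq T p Td u : is_drazin T p Td ->
  Td \o T^\dagger =1 T^\dagger \o Td -> T (Td u) = u ->
  dotp (T u) (T u) = dotp (T^\dagger u) (T^\dagger u).
Proof.
move=> [_ c1 c2 _] cT uE; rewrite adjointE -adjointEr.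
by have := comm_core (A := T) (B := Td) c1 c2 cT u; rewrite uE => ->.
Qed.

Lemma DN_norm_eq T : DN T -> exists p, forall x,
  dotp (T (iter p T x)) (T (iter p T x)) =
  dotp (T^\dagger (iter p T x)) (T^\dagger (iter p T x)).
Proof.
move=> [Td [p dT] cT]; exists p => x.
by apply: (core_norm_eq dT cT); exact: (drazin_core _ dT).
Qed.

(** At index 1 the range of [T] is that of each of its powers; this absorbs the unknown exponent [p]
    coming from [DN] of the block operator. *)
Lemma drazin1_iter T Td k x : is_drazin T 1 Td ->
  T x = iter k.+1 T (iter k Td x).
Proof.
move=> [_ _ _ c3]; elim: k x => // k IH x.
by rewrite iterS [iter k.+1 Td x]iterSr -IH; exact/esym/c3.
Qed.

(** [Te] puts the range of [T] inside that of [T^p], where [T Td] is the identity; so [Td], which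
    commutes with the adjoint, itself has exponent 1. *)
Lemma DN_index1 T : DN T -> drazin_index T 1 ->
  exists2 Td, is_drazin T 1 Td & Td \o T^\dagger =1 T^\dagger \o Td.
Proof.
move=> [Td [p dT] cT] [[Te dTe] _]; exists Td => //.
have [_ c1 c2 _] := dT; split=> // x.
change (T (T (Td x)) = T x); rewrite -(drazin_comm x dT).
by rewrite (drazin1_iter p x dTe) iterSr (drazin_core _ dT).
Qed.

Lemma drazin1_core T Td x : is_drazin T 1 Td -> T (Td (T x)) = T x.
Proof. exact: (@drazin_core T 1 Td x). Qed.

(** [T w = T u] for the core vector [u = T Td w], and [T^\dagger u = T Td (T^\dagger w) = 0]. *)
Lemma adjoint_ker T Td w : is_drazin T 1 Td ->
  Td \o T^\dagger =1 T^\dagger \o Td -> T^\dagger w = 0 -> T w = 0.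
Proof.
move=> dT cT Tw0; have [_ c1 c2 c3] := dT.
rewrite -[LHS]c3; apply: dotp_eq0; rewrite (core_norm_eq dT cT).
  by rewrite (comm_core_proj (A := T) (B := Td) c1 c2 cT) Tw0 !linear0.
by rewrite drazin1_core.
Qed.

Lemma ker_adjoint T Td w : is_drazin T 1 Td ->
  Td \o T^\dagger =1 T^\dagger \o Td -> T w = 0 -> T^\dagger w = 0.
Proof.
move=> dT cT Tw0; apply: (adjoint_ker (drazin_adjoint dT) (adjoint_comm cT)).
by rewrite adjointK.
Qed.

(** [proj] is a choice, so every candidate must be shown equal to [T Td w], and [T Td w] to be
    one. *)
Lemma proj_core T Td w : is_drazin T 1 Td ->
  Defs.proj (range T) (T @^-1` [set 0]) w = T (Td w).
Proof.
move=> dT; have [_ _ _ c3] := dT.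
rewrite /Defs.proj; case: xgetP => [u _|/(_ (T (Td w)))[]].
  move=> [[y _ <-] /= /eqP]; rewrite linearB/= subr_eq0 => /eqP Tw.
  rewrite -(drazin_comm w dT) Tw (drazin_comm (T y) dT).
  by rewrite (drazin_comm y dT); exact/esym/c3.
split; first by exists (Td w).
by rewrite /= linearB/= [T (T (Td w))]c3 subrr.
Qed.

Lemma proj_ker T Td w : is_drazin T 1 Td ->
  Defs.proj (T @^-1` [set 0]) (range T) w = w - T (Td w).
Proof.
move=> dT; have [_ _ _ c3] := dT.
rewrite /Defs.proj; case: xgetP => [u _|/(_ (w - T (Td w)))[]].
  move=> [/= Tu [y _ yE]]; rewrite -[w in RHS](subrK u) -yE.
  rewrite !linearD/= (drazin1_core _ dT).
  rewrite -(drazin_comm u dT) Tu linear0.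
  by rewrite subr0 addrAC subrr add0r.
split; first by rewrite /= linearB/= [T (T (Td w))]c3 subrr.
by rewrite opprB addrC subrK; exists (Td w).
Qed.

End drazin_normal.

(** * The upper triangular block operator *)

Section block.
Context {R : realType} {H : hilbertType R} {T S C : {bounded H -> H}}.
Local Notation A := (block_op T C \0 S).

Lemma hsum_dotE (u v : H \oplus H) :
  dotp u v = dotp u.1 v.1 + dotp u.2 v.2.
Proof. by []. Qed.

Lemma block_adjoint x y :
  A^\dagger (x, y) = (T^\dagger x, C^\dagger x + S^\dagger y).
Proof.
apply: dotp_inj => -[u v]; rewrite -adjointE.
rewrite !hsum_dotE/=.
by rewrite add0r linearDl linearDr/= !adjointE addrA.
Qed.

Lemma block_iter_fst p x : iter p A (x, 0) = (iter p T x, 0).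
Proof.
by elim: p => //= p ->; rewrite /block_op/= !linear0 !addr0.
Qed.

Lemma block_iter_snd p y : iter p A^\dagger (0, y) = (0, iter p S^\dagger y).
Proof.
by elim: p => //= p ->; rewrite block_adjoint !linear0 add0r.
Qed.

Context {Td Sd : {bounded H -> H}}.
Hypotheses (dT : is_drazin T 1 Td) (cT : Td \o T^\dagger =1 T^\dagger \o Td).
Hypotheses (dS : is_drazin S 1 Sd) (cS : Sd \o S^\dagger =1 S^\dagger \o Sd).

Lemma DN_block_left : DN A -> forall x, T (C x) = 0.
Proof.
move=> /DN_norm_eq[p Ap] x; apply: (adjoint_ker dT cT).
apply: dotp_inj => y; rewrite -adjointE dotp0.
(* [T y = T^p (T Td^p y)] puts [(T y, 0)] in the range of [A^p]. *)
rewrite (drazin1_iter p y dT) iterSr.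
set z := iter p T _; have := Ap (T (iter p Td y), 0).
rewrite block_iter_fst -/z block_adjoint !linear0 addr0.
rewrite !hsum_dotE /= !linear0 !addr0 dotp0 addr0.
rewrite (core_norm_eq dT cT); last first.
  by rewrite /z -iterSr (drazin1_core _ dT).
rewrite -[X in X = _]addr0 => H0; have Cz := esym (addrI _ H0).
by rewrite adjointEr (dotp_eq0 Cz) dot0p.
Qed.

Lemma DN_block_right : DN A -> forall x, C (S x) = 0.
Proof.
move=> /DN_adjoint/DN_norm_eq[p Ap] x.
have CS y : C (S^\dagger y) = 0.
  rewrite (drazin1_iter p y (drazin_adjoint dS)) iterSr.
  set z := iter p _ _; have := Ap (0, S^\dagger (iter p Sd^\dagger y)).
  rewrite block_iter_snd -/z block_adjoint adjointK !linear0 add0r.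
  rewrite !hsum_dotE /= !linear0 !add0r.
  rewrite (core_norm_eq (drazin_adjoint dS) (adjoint_comm cS)); last first.
    by rewrite /z -iterSr (drazin_core _ (drazin_adjoint dS)).
  rewrite !adjointK -[X in X = _]add0r => H0.
  exact: dotp_eq0 (esym (addIr _ H0)).
(* The adjoint of [CS] is [S C^\dagger = 0]; as [ker S] lies in [ker S^\dagger], also
   [S^\dagger C^\dagger = 0]. *)
apply: dotp_inj => y; rewrite dotp0 !adjointEr (ker_adjoint dS cS) ?dot0p//.
by apply: dotp_inj => w; rewrite adjointEr -adjointE CS dot0p dotp0.
Qed.

Lemma block_DN :
  (forall x, T (C x) = 0) -> (forall x, C (S x) = 0) -> DN A.
Proof.
move=> TC CS.
have [_ _ t2 t3] := dT; have [_ _ s2 s3] := dS.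
have TdC x : Td (C x) = 0.
  by rewrite -t2/= TC !linear0.
have CSd x : C (Sd x) = 0.
  by rewrite -s2/= !(drazin_comm _ dS) CS.
have CdT x : C^\dagger (T x) = 0.
  apply: dotp_inj => y; rewrite -adjointE adjointEr.
  by rewrite (ker_adjoint dT cT (TC y)) dot0p dotp0.
have SCd x : S (C^\dagger x) = 0.
  apply: (adjoint_ker dS cS); apply: dotp_inj => y.
  by rewrite -!adjointE CS dot0p dotp0.
have AE x y : A (x, y) = (T x + C y, S y) by rewrite /block_op/= add0r.
have BE x y : block_op Td \0 \0 Sd (x, y) = (Td x, Sd y).
  by rewrite /block_op/= add0r addr0.
exists (block_op Td \0 \0 Sd).
  (* Exponent 1 would force [C = 0]: [C] appears in [A] but has vanished from [A^2]. *)
  exists 2%N; split=> // -[x y].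
  - rewrite /comp/= AE !BE AE linearD/= TdC CSd.
    by rewrite (drazin_comm _ dT) (drazin_comm _ dS).
  - rewrite /comp/= AE !BE /= addr0 add0r !linearD/= TdC linear0 addr0.
    by congr pair; [exact: t2|exact: s2].
  - rewrite /comp/= BE !AE /= ?add0r CSd addr0 !CS !addr0 linearD/= TC addr0.
    by congr pair; [congr (T _); exact: t3|congr (S _); exact: s3].
move=> [x y]; rewrite /comp/= block_adjoint !BE block_adjoint linearD/=.
congr pair; first exact: cT.
congr (_ + _); last exact: cS.
(* Both off-diagonal terms vanish, since [Sd = Sd Sd S] and [Td = T Td Td]. *)
rewrite -[LHS]s2/= SCd !linear0.
by rewrite -t2/= !(drazin_comm _ dT) CdT.
Qed.

End block.

Theorem theorem2p12 (R : realType) (H : hilbertType R)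
  (H_infinite : infinite_dimensional H)
  (S T C : {bounded H -> H})
  (S_DN : DN S) (T_DN : DN T)
  (S_index1 : drazin_index S 1) (T_index1 : drazin_index T 1) :
  DN (block_op T C \0 S) <->
  [/\ entry T S C 0 0 =1 cst 0, entry T S C 0 1 =1 cst 0 &
      entry T S C 1 0 =1 cst 0].
Proof.
have [Sd dS cS] := DN_index1 S_DN S_index1.
have [Td dT cT] := DN_index1 T_DN T_index1.
have [_ _ _ t3] := dT; have [_ _ _ s3] := dS.
have r0 : rev_ord (0 : 'I_2) = 1 by exact: val_inj.
have r1 : rev_ord (1 : 'I_2) = 0 by exact: val_inj.
rewrite /entry r0 r1 /summand !eqxx (_ : (1 == 0 :> 'I_2) = false)//.
split=> [DNA|[C11 C12 C21]].
  have TC := DN_block_left dT cT DNA.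
  have CS := DN_block_right dS cS DNA.
  have TTdC x : T (Td (C x)) = 0 by rewrite -(drazin_comm _ dT) TC linear0.
  split=> x /=; rewrite ?(proj_core _ dT) ?TTdC ?(proj_ker _ dT) ?TTdC ?subr0//.
  by have /set_mem[y _ <-] := valP x.
have rS x : range S (S x) by exists x.
have TC1 x : T (Td (C (S x))) = 0.
  by rewrite -(proj_core _ dT); exact: (C11 (exist _ (S x) (mem_set (rS x)))).
have TC2 x : S x = 0 -> T (Td (C x)) = 0.
  move=> Sx; rewrite -(proj_core _ dT).
  exact: (C12 (exist _ x (mem_set (Sx : (S @^-1` [set 0]) x)))).
have CS x : C (S x) = 0.
  have := C21 (exist _ (S x) (mem_set (rS x))).
  by rewrite (proj_ker _ dT)/= TC1 subr0.
apply: (block_DN dT cT dS cS _ CS) => x.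
(* Split [x] into its range part [S Sd x], killed by [C], and a kernel part, where [TC2] and
   [T = T T Td] apply. *)
have SxE : S (x - S (Sd x)) = 0.
  by rewrite linearB/= [S (S (Sd x))]s3 subrr.
rewrite -[x](subrK (S (Sd x))) linearD/= CS addr0.
by have /= <- := t3 (C (x - S (Sd x))); rewrite TC2// linear0.
Qed.
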